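(* Let $\mathcal{K}$ be a mean whose domain contains bounded sets only, and let $\hat{\mathcal{K}}$ be its extension. If $\mathcal{K}$ is monotone, then $\hat{\mathcal{K}}$ is monotone.
   Context: A (generalized) mean is a function $\mathcal{K}: Dom(\mathcal{K})\to\bar{\mathbb{R}}=\mathbb{R}\cup\{-\infty,+\infty\}$, where $Dom(\mathcal{K})$ is a collection of nonempty subsets of $\mathbb{R}$, with $\inf H\le\mathcal{K}(H)\le\sup H$ for all $H\in Dom(\mathcal{K})$ (so values on bounded sets are real). Standing assumption on the domain of the original mean $\mathcal{K}$: it is closed under finite unions and nonempty finite intersections, and if $H\in Dom(\mathcal{K})$ and $I$ is a (finite or infinite) interval with $H\cap I\neq\emptyset$ then $H\cap I\in Dom(\mathcal{K})$. Extension: let $\mathcal{K}$ be a mean whose domain contains bounded sets only. Let $\emptyset\neq H\subset\mathbb{R}$ be such that $H\cap[x,y]\in Dom(\mathcal{K})$ for all real $x\le y$ with $H\cap[x,y]\neq\emptyset$. Set $\hat{\mathcal{K}}(H)=\lim_{x\to-\infty,\,y\to+\infty}\mathcal{K}(H\cap[x,y])$ if this double limit (with $x,y$ tending independently) exists in $\bar{\mathbb{R}}$; $Dom(\hat{\mathcal{K}})$ consists of all such $H$ for which the limit exists. A mean $\mathcal{M}$ is monotone if for all $H_1,H_2$ with $H_1,H_2,H_1\cup H_2\in Dom(\mathcal{M})$, $\sup H_1\le\inf H_2$ implies $\mathcal{M}(H_1)\le\mathcal{M}(H_1\cup H_2)\le\mathcal{M}(H_2)$. *)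

(* Defs.v *)
From HB Require Import structures.
From mathcomp Require Import all_boot all_order all_algebra.
From mathcomp Require Import all_classical all_reals all_analysis.
Import Order.TTheory GRing.Theory Num.Theory.
Import numFieldNormedType.Exports.

Set Implicit Arguments.
Unset Strict Implicit.
Unset Printing Implicit Defensive.

Local Open Scope classical_set_scope.
Local Open Scope ring_scope.

(* A generalized mean is given by its domain [D] and a total function [K]
   whose values outside [D] are irrelevant. *)

Definition is_mean (R : realType) (D : set (set R)) (K : set R -> \bar R) :
    Prop :=
  forall H, D H ->
    [/\ H !=set0,
        (ereal_inf (EFin @` H) <= K H)%E &
        (K H <= ereal_sup (EFin @` H))%E].

(* Closure under binary intersections gives all nonempty finite ones, since
   the partial intersections of such a family are nonempty as well. *)
Definition admissible_domain (R : realType) (D : set (set R)) : Prop :=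
  [/\ forall A B, D A -> D B -> D (A `|` B),
      forall A B, D A -> D B -> A `&` B !=set0 -> D (A `&` B) &
      forall A (i : interval R),
        D A -> A `&` [set` i] !=set0 -> D (A `&` [set` i])].

Definition monotone_mean (R : realType) (D : set (set R))
    (K : set R -> \bar R) : Prop :=
  forall H1 H2, D H1 -> D H2 -> D (H1 `|` H2) ->
    (ereal_sup (EFin @` H1) <= ereal_inf (EFin @` H2))%E ->
    (K H1 <= K (H1 `|` H2))%E /\ (K (H1 `|` H2) <= K H2)%E.

(* The product filter makes the endpoints tend to -oo and +oo
   independently. *)
Definition truncations (R : realType) (K : set R -> \bar R) (H : set R) :
    set_system (\bar R) :=
  (fun p : R * R => K (H `&` `[p.1, p.2])) @
    filter_prod (ninfty_nbhs R) (pinfty_nbhs R).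

Definition ext_dom (R : realType) (D : set (set R)) (K : set R -> \bar R) :
    set (set R) :=
  [set H | [/\ H !=set0,
               forall x y : R, x <= y -> H `&` `[x, y] !=set0 ->
                 D (H `&` `[x, y]) &
               cvg (truncations K H)]].

Definition ext_mean (R : realType) (K : set R -> \bar R) (H : set R) :
    \bar R :=
  lim (truncations K H).

(* Main.v *)
Require Import Defs.
From HB Require Import structures.
From mathcomp Require Import all_boot all_order all_algebra.
From mathcomp Require Import all_classical all_reals all_analysis.
Import Order.TTheory GRing.Theory Num.Theory.
Import numFieldNormedType.Exports.

Set Implicit Arguments.
Unset Strict Implicit.
Unset Printing Implicit Defensive.

Local Open Scope classical_set_scope.
Local Open Scope ring_scope.

(** Fix a point in each of [H1] and [H2].  As soon as the window from [x] to [y]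
    contains both points ([near_window_contains]), the truncations of [H1], [H2]
    and their union are nonempty, hence lie in the domain of [K], and the
    monotonicity of [K] applies to them ([monotone_mean_window]).  Both
    inequalities therefore hold for all sufficiently large windows, and weak
    inequalities pass to the limit along the proper filter of windows. *)

Lemma near_window_contains (R : realType) (a : R) :
  \forall p \near filter_prod (ninfty_nbhs R) (pinfty_nbhs R),
    a \in `[p.1, p.2].
Proof.
exists ([set x | x <= a], [set y | a <= y]) => /=.
  by split; [apply: nbhs_ninfty_le | apply: nbhs_pinfty_ge];
    exact: num_real.
by move=> [x y] [/= xa ay]; rewrite in_itv /= xa ay.
Qed.

(** Truncation distributes over the union, and shrinking both sets preserves
    their separation: it can only lower the supremum of the left one and raise
    the infimum of the right one.  The points [a] and [b] witness that the
    truncations are nonempty, without which they need not be in [D]. *)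
Lemma monotone_mean_window (R : realType) (D : set (set R))
    (K : set R -> \bar R) (H1 H2 : set R) (a b x y : R) :
  monotone_mean D K ->
  ext_dom D K H1 -> ext_dom D K H2 -> ext_dom D K (H1 `|` H2) ->
  (ereal_sup (EFin @` H1) <= ereal_inf (EFin @` H2))%E ->
  H1 a -> H2 b -> a \in `[x, y] -> b \in `[x, y] ->
  (K (H1 `&` `[x, y]) <= K ((H1 `|` H2) `&` `[x, y]))%E /\
  (K ((H1 `|` H2) `&` `[x, y]) <= K (H2 `&` `[x, y]))%E.
Proof.
move=> hmono [_ D1 _] [_ D2 _] [_ D12 _] h12 H1a H2b axy bxy.
have xy : x <= y by move: axy; rewrite in_itv /= => /andP[/le_trans]; apply.
rewrite setIUl; apply: hmono.
- by apply: D1 => //; exists a.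
- by apply: D2 => //; exists b.
- by rewrite -setIUl; apply: D12 => //; exists a; split => //; left.
- apply: (@le_trans _ _ (ereal_sup (EFin @` H1))).
    by apply: ereal_sup_le; apply: image_subset; exact: subIsetl.
  apply: (le_trans h12).
  by apply: ereal_inf_le_tmp; apply: image_subset; exact: subIsetl.
Qed.

Theorem proposition4p11 (R : realType) (D : set (set R)) (K : set R -> \bar R)
    (hK : is_mean D K)
    (hD : admissible_domain D)
    (hbounded : forall H, D H -> bounded_set H)
    (hmono : monotone_mean D K) :
  monotone_mean (ext_dom D K) (ext_mean K).
Proof.
move=> H1 H2 dom1 dom2 dom12 h12.
have [[a H1a] _ cvg1] := dom1.
have [[b H2b] _ cvg2] := dom2.
have [_ _ cvg12] := dom12.
split; apply: lee_lim => //; near=> p.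
all: have axy : a \in `[p.1, p.2] by near: p; exact: near_window_contains.
all: have bxy : b \in `[p.1, p.2] by near: p; exact: near_window_contains.
all: by case: (monotone_mean_window hmono dom1 dom2 dom12 h12 H1a H2b axy bxy).
Unshelve. all: by end_near.
Qed.
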